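(* Let $n\ge1$. The finite representation property holds for the signature $(\langle\ \rangle;,\mathsf A_1,\dots,\mathsf A_n,\mathsf F_1,\dots,\mathsf F_n,\sqcup)$ for representation by $n$-ary partial functions and for representation by injective $n$-ary partial functions. That is: every finite algebra of this signature that is representable by $n$-ary partial functions is isomorphic to an algebra of $n$-ary partial functions with a finite base; and every finite algebra of this signature that is representable by injective $n$-ary partial functions is isomorphic to an algebra of $n$-ary partial functions that has a finite base and all of whose elements are injective.
   Context: Fix $n\ge 1$; $i$ ranges over $\{1,\dots,n\}$. The signature has an $(n+1)$-ary operation (composition), written $\langle a_1,\dots,a_n\rangle ; b$ (also $\boldsymbol a; b$), unary operations $\mathsf A_1,\dots,\mathsf A_n,\mathsf F_1,\dots,\mathsf F_n$, and a binary operation $\sqcup$. Algebras are nonempty. An $n$-ary partial function on a set $X$ is a set $f\subseteq X^{n+1}$ such that $(\boldsymbol x,y),(\boldsymbol x,z)\in f$ implies $y=z$ (where $\boldsymbol x\in X^n$); it is injective if $(\boldsymbol x,z),(\boldsymbol y,z)\in f$ implies $\boldsymbol x=\boldsymbol y$. An algebra of $n$-ary partial functions of this signature is an algebra whose elements are $n$-ary partial functions, for which there are a set $X$ (the base) and an equivalence relation $E$ on $X$ such that every tuple $(x_1,\dots,x_{n+1})$ in every element lies in $X^{n+1}$ and has pairwise $E$-equivalent entries, and whose operations are $\boldsymbol f; g=\{(\boldsymbol x,z)\in X^{n+1} : \exists \boldsymbol y\in X^n,\ (\boldsymbol x,y_i)\in f_i \text{ for each } i \text{ and } (\boldsymbol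 y,z)\in g\}$, $\mathsf A_i(f)=\{(\boldsymbol x,x_i)\in X^{n+1} : x_1,\dots,x_n \text{ all } E\text{-equivalent and there is no } y\in X \text{ with } (\boldsymbol x,y)\in f\}$, $\mathsf F_i(f)=\{(\boldsymbol x,x_i)\in X^{n+1} : (\boldsymbol x,x_i)\in f\}$ (fixset), and preferential union: $(f\sqcup g)(\boldsymbol x)$ is $f(\boldsymbol x)$ if $f(\boldsymbol x)$ is defined, $g(\boldsymbol x)$ if $f(\boldsymbol x)$ is undefined but $g(\boldsymbol x)$ is defined, and undefined otherwise. An algebra is representable by (injective) $n$-ary partial functions if it is isomorphic to an algebra of $n$-ary partial functions of the same signature (all of whose elements are injective). *)

(* Defs.v *)
From Stdlib Require Export RelationClasses.
From mathcomp Require Export all_boot boolp classical_sets functions cardinality.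

Set Implicit Arguments.
Unset Strict Implicit.
Unset Printing Implicit Defensive.

Local Open Scope classical_set_scope.

Record algebra (n : nat) := Algebra {
  carrier :> Type;
  carrier_nonempty : inhabited carrier;
  op_comp : ('I_n -> carrier) -> carrier -> carrier;
  op_antidom : 'I_n -> carrier -> carrier;
  op_fix : 'I_n -> carrier -> carrier;
  op_pref : carrier -> carrier -> carrier
}.

Definition is_hom (n : nat) (A B : algebra n) (h : A -> B) : Prop :=
  [/\ forall (a : 'I_n -> A) (b : A),
        h (op_comp a b) = op_comp (fun i => h (a i)) (h b),
      forall (i : 'I_n) (a : A), h (op_antidom i a) = op_antidom i (h a),
      forall (i : 'I_n) (a : A), h (op_fix i a) = op_fix i (h a)
    & forall a b : A, h (op_pref a b) = op_pref (h a) (h b)].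

Definition isomorphic (n : nat) (A B : algebra n) : Prop :=
  exists h : A -> B, bijective h /\ is_hom h.

(* A subset of X^{n+1}, each tuple being split as (its first n entries,
   its last entry). *)
Definition nary_rel (n : nat) (X : Type) := set (('I_n -> X) * X).

Definition is_pfun (n : nat) (X : Type) (f : nary_rel n X) : Prop :=
  forall x y z, f (x, y) -> f (x, z) -> y = z.

Definition is_injective (n : nat) (X : Type) (f : nary_rel n X) : Prop :=
  forall x y z, f (x, z) -> f (y, z) -> x = y.

Definition pairwise_related (n : nat) (X : Type) (E : X -> X -> Prop)
    (x : 'I_n -> X) : Prop :=
  forall i j, E (x i) (x j).

(* For E reflexive and symmetric: all n+1 entries of each tuple of f are
   pairwise E-related. *)
Definition entries_related (n : nat) (X : Type) (E : X -> X -> Prop)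
    (f : nary_rel n X) : Prop :=
  forall x y, f (x, y) -> pairwise_related E x /\ forall i, E (x i) y.

Section Operations.
Variables (n : nat) (X : Type) (E : X -> X -> Prop).
Implicit Types f g : nary_rel n X.

Definition defined_at f (x : 'I_n -> X) : Prop := exists y, f (x, y).

Definition pf_comp (f : 'I_n -> nary_rel n X) g : nary_rel n X :=
  [set p | exists y : 'I_n -> X, (forall i, f i (p.1, y i)) /\ g (y, p.2)].

Definition pf_antidom (i : 'I_n) f : nary_rel n X :=
  [set p | [/\ p.2 = p.1 i, pairwise_related E p.1 & ~ defined_at f p.1]].

Definition pf_fix (i : 'I_n) f : nary_rel n X :=
  [set p | p.2 = p.1 i /\ f (p.1, p.1 i)].

Definition pf_pref f g : nary_rel n X :=
  [set p | f p \/ ~ defined_at f p.1 /\ g p].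

End Operations.

Record pfun_algebra (n : nat) := PfunAlgebra {
  base : Type;
  base_rel : base -> base -> Prop;
  base_rel_equiv : Equivalence base_rel;
  elems : set (nary_rel n base);
  elems_nonempty : elems !=set0;
  elems_pfun : forall f, elems f -> is_pfun f;
  elems_related : forall f, elems f -> entries_related base_rel f;
  elems_comp : forall f g,
    (forall i, elems (f i)) -> elems g -> elems (pf_comp f g);
  elems_antidom : forall i f, elems f -> elems (pf_antidom base_rel i f);
  elems_fix : forall i f, elems f -> elems (pf_fix i f);
  elems_pref : forall f g, elems f -> elems g -> elems (pf_pref f g)
}.

Arguments elems {n} P f : rename.
Arguments elems_nonempty {n} P : rename.

Section AlgebraOf.
Variables (n : nat) (P : pfun_algebra n).
Implicit Types f g : set_type (elems P).

Lemma elems_inhabited : inhabited (set_type (elems P)).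
Proof. by case: (elems_nonempty P) => f Pf; exists; exists f; exact: mem_set. Qed.

Definition alg_comp (f : 'I_n -> set_type (elems P)) g : set_type (elems P) :=
  SigSub (mem_set (elems_comp (fun i => set_valP (f i)) (set_valP g))).

Definition alg_antidom (i : 'I_n) f : set_type (elems P) :=
  SigSub (mem_set (elems_antidom i (set_valP f))).

Definition alg_fix (i : 'I_n) f : set_type (elems P) :=
  SigSub (mem_set (elems_fix i (set_valP f))).

Definition alg_pref f g : set_type (elems P) :=
  SigSub (mem_set (elems_pref (set_valP f) (set_valP g))).

Definition algebra_of : algebra n :=
  Algebra elems_inhabited alg_comp alg_antidom alg_fix alg_pref.

End AlgebraOf.

Definition finite_algebra (n : nat) (A : algebra n) : Prop :=
  finite_set [set: A].

Definition has_finite_base (n : nat) (P : pfun_algebra n) : Prop :=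
  finite_set [set: base P].

Definition all_injective (n : nat) (P : pfun_algebra n) : Prop :=
  forall f, elems P f -> is_injective f.

Definition representable (n : nat) (A : algebra n) : Prop :=
  exists P : pfun_algebra n, isomorphic A (algebra_of P).

Definition inj_representable (n : nat) (A : algebra n) : Prop :=
  exists P : pfun_algebra n, all_injective P /\ isomorphic A (algebra_of P).

(* Main.v *)
Require Import Defs.

Set Implicit Arguments.
Unset Strict Implicit.
Unset Printing Implicit Defensive.

Local Open Scope classical_set_scope.

(** The idea is that a representation over an arbitrary base can be cut down to
    finitely many small closed pieces.  Let [P] be an algebra of [n]-ary partial
    functions on [X] with finitely many elements.  For a tuple [p] of points of
    [X] let the orbit of [p] be the set of all values [f p], for [f] in [P].  It
    is finite because [P] is, it is closed under all elements of [P] because [P]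
    is closed under composition, and, when the entries of [p] are related, it
    contains these entries because suitable antidomains act at [p] as the
    projections ([projection_at]).  Being undefined at a tuple is the only
    non-local ingredient of the operations, and on tuples of an orbit it means the
    same thing inside the orbit and in [X] ([defined_at_restrict]); hence
    restriction to an orbit preserves all the operations, and clearly
    injectivity.

    One orbit may identify different elements, but two different elements differ
    at some tuple [p], and then their restrictions to the orbit of [p] differ
    ([restrict_inj]).  Finitely many tuples separate the finitely many elements
    ([finite_separating]), so the disjoint union of their orbits, with the orbits
    as the classes of the equivalence relation, is the required finite base. *)

(** * Finite sets *)

Lemma finite_functional_image (T U : Type) (D : set T) (R : T -> U -> Prop) :
  finite_set D -> (forall d u v, R d u -> R d v -> u = v) ->
  finite_set [set u | exists2 d, D d & R d u].
Proof.
move=> finD Rfun.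
rewrite (_ : [set u | _] = \bigcup_(d in D) [set u | R d u]) //.
apply: bigcup_finite => // d _.
have [[u Rdu]|noR] := pselect (exists u, R d u).
  by apply: (sub_finite_set _ (finite_set1 u)) => v Rdv; exact: Rfun Rdv Rdu.
rewrite (_ : [set u | _] = set0) ?finite_set0 //.
by rewrite -subset0 => u Rdu; apply: noR; exists u.
Qed.

(** Choosing one witness for each [d] that has one makes the relation functional. *)
Lemma finite_witnesses (T U : Type) (D : set T) (R : T -> U -> Prop) :
  finite_set D ->
  exists S : set U, finite_set S /\
    forall d u, D d -> R d u -> exists2 v, S v & R d v.
Proof.
move=> finD.
pose R' d u := exists ex : (exists v, R d v), u = projT1 (cid ex).
exists [set u | exists2 d, D d & R' d u]; split.
  apply: finite_functional_image => // d u v [ex ->] [ex' ->].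
  by rewrite (Prop_irrelevance ex ex').
move=> d u Dd Rdu; have ex : exists v, R d v by exists u.
by exists (projT1 (cid ex)); [exists d => //; exists ex | case: (cid ex)].
Qed.

(** One witness for each pair of distinct members of [D] suffices. *)
Lemma finite_separating (W Y : Type) (D : set (set (W * Y))) :
  finite_set D ->
  exists S : set W, finite_set S /\
    forall f g, D f -> D g ->
      (forall p y, S p -> f (p, y) <-> g (p, y)) -> f = g.
Proof.
move=> finD.
pose R (d : set (W * Y) * set (W * Y)) p :=
  exists y, ~ (d.1 (p, y) <-> d.2 (p, y)).
have [S [finS SP]] := finite_witnesses R (finite_setX finD finD).
exists S; split=> // f g Df Dg fg.
apply/funext => -[p y]; apply/propext; apply: contrapT => nfg.
have [||p' Sp' [y' []]] := SP (f, g) p; [by split | by exists y |].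
exact: fg.
Qed.

(** * Restriction to orbits *)

Section Restriction.
Variables (n : nat) (P : pfun_algebra n) (S : set ('I_n -> base P)).
Implicit Types (f g : nary_rel n (base P)) (p : 'I_n -> base P).

(** The disjoint union of the orbits of the tuples in [S]: the point [x] of the
    orbit of [p] is encoded as [(p, x)]. *)
Definition orbits : set (('I_n -> base P) * base P) :=
  [set z | S z.1 /\ exists2 f, elems P f & f z].

Definition gen (z : set_type orbits) : 'I_n -> base P := (set_val z).1.
Definition pt (z : set_type orbits) : base P := (set_val z).2.

Definition same_gen (z w : set_type orbits) : Prop := gen z = gen w.

Definition restrict f : nary_rel n (set_type orbits) :=
  [set q | (forall i, gen (q.1 i) = gen q.2) /\ f (pt \o q.1, pt q.2)].

Lemma finite_orbits :
  finite_set S -> finite_set (elems P) -> finite_set [set: set_type orbits].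
Proof.
move=> finS finP.
have fin : finite_set orbits.
  pose R (d : ('I_n -> base P) * nary_rel n (base P)) z :=
    [/\ z.1 = d.1, elems P d.2 & d.2 z].
  have Rfun d z w : R d z -> R d w -> z = w.
    case: d z w => [p f] [p1 x] [p2 y] [/= -> Pf fx] [/= -> _ fy].
    by rewrite (elems_pfun Pf fx fy).
  apply: sub_finite_set (finite_functional_image (finite_setX finS finP) Rfun).
  by move=> [p x] [/= Sp [f Pf fpx]]; exists (p, f); split.
have inj : {in set_val @^-1` orbits &, injective (@set_val _ orbits)}.
  by move=> z w _ _ /val_inj.
apply: sub_finite_set (finite_preimage inj fin).
by move=> z _; exact: set_valP.
Qed.

Lemma orbits_ext z w : gen z = gen w -> pt z = pt w -> z = w.
Proof.
move=> eg ep; apply: val_inj.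
by rewrite [LHS]surjective_pairing [RHS]surjective_pairing; congr (_, _).
Qed.

Lemma orbit_of_elem f p x :
  S p -> elems P f -> f (p, x) -> exists z, gen z = p /\ pt z = x.
Proof.
move=> Sp Pf fpx; have zP : orbits (p, x) by split => //; exists f.
by exists (SigSub (mem_set zP)).
Qed.

(** A value [f (g_1 p, ..., g_n p)] is the value at [p] of a composite. *)
Lemma orbit_closed f p (x : 'I_n -> set_type orbits) y :
  S p -> (forall i, gen (x i) = p) -> elems P f -> f (pt \o x, y) ->
  exists z, gen z = p /\ pt z = y.
Proof.
move=> Sp gx Pf fxy.
have /choice[g gP] i : exists g, elems P g /\ g (p, pt (x i)).
  have [_ [g Pg gx_i]] := set_valP (x i).
  by exists g; rewrite -(gx i) /gen /pt -surjective_pairing.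
apply: (@orbit_of_elem (pf_comp g f)) => //.
  by apply: elems_comp => // i; case: (gP i).
by exists (pt \o x); split => // i; case: (gP i).
Qed.

Lemma gen_in z : S (gen z).
Proof. by case: (set_valP z). Qed.

(** Both points are related to the entry [gen z i]. *)
Lemma orbit_related (i : 'I_n) z w : gen z = gen w -> base_rel (pt z) (pt w).
Proof.
have rel u : base_rel (gen u i) (pt u).
  have [_ [f Pf fu]] := set_valP u.
  move: fu; rewrite [X in f X]surjective_pairing => fu.
  by have [_] := elems_related Pf fu; apply.
have [_ sym tr] := base_rel_equiv P.
by move=> e; apply: tr (sym _ _ (rel z)) _; rewrite e; exact: rel.
Qed.

(** Closure of the orbits makes undefinedness a local property. *)
Lemma defined_at_restrict f (x : 'I_n -> set_type orbits) z :
  elems P f -> (forall i, gen (x i) = gen z) ->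
  defined_at (restrict f) x <-> defined_at f (pt \o x).
Proof.
move=> Pf gx; split=> [[w [_ fxw]]|[y fxy]]; first by exists (pt w).
have [w [gw wy]] := orbit_closed (gen_in z) gx Pf fxy.
by exists w; split; [move=> i; rewrite gx gw | rewrite /= wy].
Qed.

(** The intermediate tuple, found in [base P], lies in the orbit of the arguments
    and so is already present in the restricted base. *)
Lemma restrict_comp (f : 'I_n -> nary_rel n (base P)) g :
  (forall i, elems P (f i)) ->
  restrict (pf_comp f g) = pf_comp (restrict \o f) (restrict g).
Proof.
move=> Pf; apply/seteqP; split=> [[x w] [/= gx [y [fxy gyw]]]|[x w] [y [fxy]]].
  have /choice[z zP] i : exists z, gen z = gen w /\ pt z = y i.
    exact: orbit_closed (gen_in w) gx (Pf i) (fxy i).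
  have yE : y = pt \o z by apply: funext => i; case: (zP i).
  exists z; split=> [i|]; last first.
    by split=> /= [i|]; [case: (zP i) | rewrite -yE].
  have [gz zy] := zP i; split=> /= [j|]; first by rewrite gx gz.
  by rewrite zy; exact: fxy.
move=> [/= gy gyw]; split=> /= [i|]; first by case: (fxy i) => /= ->.
by exists (pt \o y); split=> // i; case: (fxy i).
Qed.

Lemma restrict_antidom i f : elems P f ->
  restrict (pf_antidom (@base_rel n P) i f) =
  pf_antidom same_gen i (restrict f).
Proof.
move=> Pf; apply/seteqP; split=> [[x w]|[x w]] /=.
  move=> [/= gx [/= ptw _ undef]]; split=> //=.
  - by apply: orbits_ext; rewrite ?gx.
  - by move=> j k; rewrite /same_gen !gx.
  - by rewrite (defined_at_restrict Pf gx).
move=> [/= -> gx undef]; have gxi j : gen (x j) = gen (x i) by exact: gx.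
split=> //=; split=> //=.
- by move=> j k; exact: (orbit_related i (gx j k)).
- by rewrite -(defined_at_restrict Pf gxi).
Qed.

Lemma restrict_fix i f : restrict (pf_fix i f) = pf_fix i (restrict f).
Proof.
apply/seteqP; split=> [[x w]|[x w]] /=.
  move=> [/= gx [/= ptw fx]]; have -> : w = x i by apply: orbits_ext; rewrite ?gx.
  by split=> //; split=> //= j; rewrite !gx.
by move=> [/= -> [gx fx]]; split.
Qed.

Lemma restrict_pref f g : elems P f ->
  restrict (pf_pref f g) = pf_pref (restrict f) (restrict g).
Proof.
move=> Pf; apply/seteqP; split=> [[x w]|[x w]] /=.
  move=> [/= gx [fx|[undef gxw]]]; first by left.
  by right; split=> //=; rewrite (defined_at_restrict Pf gx).
move=> [[gx fx]|[undef [gx gxw]]]; split=> //; first by left.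
by right; split=> //=; rewrite -(defined_at_restrict Pf gx).
Qed.

(** The index [i] is what makes the orbit of the value known: without arguments,
    the restriction of a constant would take one value in each orbit. *)
Lemma restrict_pfun (i : 'I_n) f : is_pfun f -> is_pfun (restrict f).
Proof.
move=> ff x y z [/= gy fy] [/= gz fz]; apply: orbits_ext; last exact: ff fy fz.
by rewrite -(gy i) gz.
Qed.

Lemma restrict_injective f : is_injective f -> is_injective (restrict f).
Proof.
move=> finj x y z [/= gx fx] [/= gy fy]; apply/funext => i.
apply: orbits_ext; first by rewrite gx gy.
exact: (congr1 (@^~ i) (finj _ _ _ fx fy)).
Qed.

Lemma restrict_related f : entries_related same_gen (restrict f).
Proof. by move=> x y [/= gx _]; split=> // i j; rewrite /same_gen !gx. Qed.

(** Any element [f] gives a projection at [p]: if [f] is undefined at [p], then its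
    [i]-th antidomain sends [p] to [p i]; otherwise the [i]-th antidomain of this
    antidomain does. *)
Lemma projection_at i p : pairwise_related (@base_rel n P) p ->
  exists2 f, elems P f & f (p, p i).
Proof.
move=> relp; have [f Pf] := elems_nonempty P.
have [[y fy]|undef] := pselect (defined_at f p).
  exists (pf_antidom (@base_rel n P) i (pf_antidom (@base_rel n P) i f)).
    by do 2!apply: elems_antidom.
  by split=> //= -[z [_ _ []]]; exists y.
exists (pf_antidom (@base_rel n P) i f); first exact: elems_antidom.
by split.
Qed.

(** Since the entries of [p] lie in its orbit, every tuple with arguments [p] that
    occurs in an element is visible in the restricted base. *)
Lemma restrict_lift f p y : S p -> elems P f -> f (p, y) ->
  exists q, (p, y) = (pt \o q.1, pt q.2) /\ forall g, restrict g q <-> g (p, y).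
Proof.
move=> Sp Pf fpy.
have [relp _] := elems_related Pf fpy.
have /choice[x xP] i : exists z, gen z = p /\ pt z = p i.
  by have [g Pg gp] := projection_at i relp; exact: orbit_of_elem gp.
have [w [gw wy]] := orbit_of_elem Sp Pf fpy.
have pE : pt \o x = p by apply/funext => i; case: (xP i).
exists (x, w); rewrite /= pE wy; split=> // g.
rewrite /restrict /= pE wy; split=> [[]//|gp]; split=> // i.
by rewrite gw; case: (xP i).
Qed.

Lemma restrict_inj :
  (forall f g, elems P f -> elems P g ->
     (forall p y, S p -> f (p, y) <-> g (p, y)) -> f = g) ->
  forall f g, elems P f -> elems P g -> restrict f = restrict g -> f = g.
Proof.
move=> sepS f g Pf Pg fg; apply: sepS => // p y Sp; split=> [fp|gp].
  by have [q [_ qP]] := restrict_lift Sp Pf fp; apply/qP; rewrite -fg; apply/qP.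
by have [q [_ qP]] := restrict_lift Sp Pg gp; apply/qP; rewrite fg; apply/qP.
Qed.

Lemma same_gen_equiv : Equivalence same_gen.
Proof. by split=> [x|x y|x y z]; rewrite /same_gen // => ->. Qed.

Definition restrict_algebra (i0 : 'I_n) : pfun_algebra n.
Proof.
apply: (@PfunAlgebra n _ _ same_gen_equiv (restrict @` elems P)).
- by have [f Pf] := elems_nonempty P; exists (restrict f), f.
- by move=> _ [f Pf <-]; apply: restrict_pfun (elems_pfun Pf).
- by move=> _ [f Pf <-]; exact: restrict_related.
- move=> f' _ f'P [g Pg <-].
  have /choice[f fP] i : exists f, elems P f /\ restrict f = f' i.
    by have [f] := f'P i; exists f.
  have Pf i : elems P (f i) by case: (fP i).
  have -> : f' = restrict \o f by apply/funext => i; case: (fP i).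
  by rewrite -restrict_comp //; exists (pf_comp f g) => //; exact: elems_comp.
- move=> i _ [f Pf <-]; rewrite -restrict_antidom //.
  by exists (pf_antidom (@base_rel n P) i f) => //; exact: elems_antidom.
- move=> i _ [f Pf <-]; rewrite -restrict_fix.
  by exists (pf_fix i f) => //; exact: elems_fix.
- move=> _ _ [f Pf <-] [g Pg <-]; rewrite -restrict_pref //.
  by exists (pf_pref f g) => //; exact: elems_pref.
Defined.

Lemma restrict_isomorphic i0 :
  (forall f g, elems P f -> elems P g -> restrict f = restrict g -> f = g) ->
  isomorphic (algebra_of P) (algebra_of (restrict_algebra i0)).
Proof.
move=> rinj.
have rP (f : algebra_of P) : elems (restrict_algebra i0) (restrict (set_val f)).
  by exists (set_val f) => //; exact: set_valP.
pose h (f : algebra_of P) : algebra_of (restrict_algebra i0) :=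
  SigSub (mem_set (rP f)).
exists h; split.
  have hinj : injective h.
    move=> f g /(congr1 val) /= fg; apply: val_inj => /=.
    by apply: rinj fg; exact: set_valP.
  have /choice[k kK] b : exists a, h a = b.
    have [f Pf fb] := set_valP b.
    by exists (SigSub (mem_set Pf)); apply: val_inj.
  by exists k => // a; apply: hinj; rewrite kK.
split=> [a b|i a|i a|a b]; apply: val_inj => /=.
- by rewrite restrict_comp // => i; exact: set_valP.
- by rewrite restrict_antidom //; exact: set_valP.
- exact: restrict_fix.
- by rewrite restrict_pref //; exact: set_valP.
Qed.

End Restriction.

(** * The finite base *)

Lemma isomorphic_trans n (A B C : algebra n) :
  isomorphic A B -> isomorphic B C -> isomorphic A C.
Proof.
move=> [h [bijh [h1 h2 h3 h4]]] [k [bijk [k1 k2 k3 k4]]].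
exists (k \o h); split; first exact: bij_comp.
by split=> *; rewrite /= ?h1 ?h2 ?h3 ?h4 ?k1 ?k2 ?k3 ?k4.
Qed.

Lemma finite_elems n (A : algebra n) (P : pfun_algebra n) :
  finite_algebra A -> isomorphic A (algebra_of P) -> finite_set (elems P).
Proof.
move=> finA [h [[k _ kK] _]].
apply: sub_finite_set (finite_image (fun a => set_val (h a)) finA).
by move=> f Pf; exists (k (SigSub (mem_set Pf))) => //; rewrite kK.
Qed.

Lemma finite_base_iso n (P : pfun_algebra n) :
  (1 <= n)%N -> finite_set (elems P) ->
  exists Q : pfun_algebra n,
    [/\ has_finite_base Q, all_injective P -> all_injective Q
      & isomorphic (algebra_of P) (algebra_of Q)].
Proof.
move=> n_ge1 finP; pose i0 : 'I_n := Ordinal n_ge1.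
have [S [finS sepS]] := finite_separating finP.
exists (restrict_algebra S i0); split.
- exact: finite_orbits.
- by move=> injP _ [f Pf <-]; exact/restrict_injective/injP.
- exact/restrict_isomorphic/restrict_inj.
Qed.

Theorem corollary8p8 (n : nat) (n_ge1 : (1 <= n)%N) :
  (forall A : algebra n, finite_algebra A -> representable A ->
     exists P : pfun_algebra n,
       has_finite_base P /\ isomorphic A (algebra_of P)) /\
  (forall A : algebra n, finite_algebra A -> inj_representable A ->
     exists P : pfun_algebra n,
       [/\ has_finite_base P, all_injective P & isomorphic A (algebra_of P)]).
Proof.
split=> A finA.
  move=> [P isoP]; have [Q [finQ _ isoQ]] :=
    finite_base_iso n_ge1 (finite_elems finA isoP).
  by exists Q; split=> //; exact: isomorphic_trans isoQ.
move=> [P [injP isoP]]; have [Q [finQ injQ isoQ]] :=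
  finite_base_iso n_ge1 (finite_elems finA isoP).
by exists Q; split=> //; [exact: injQ | exact: isomorphic_trans isoQ].
Qed.
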